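(* Let $(\alpha_1,\alpha_2,\phi,g)$ be a metric contact pair on a smooth manifold $M$, and let $\mathcal{F}_1,\mathcal{F}_2$ be the characteristic foliations of $\alpha_1,\alpha_2$ respectively. Then the tensor $\phi$ is decomposable if and only if the foliations $\mathcal{F}_1$ and $\mathcal{F}_2$ are orthogonal with respect to $g$.
   Context: All objects are smooth; $\Gamma(TM)$ denotes the space of vector fields on $M$. A contact pair of type $(h,k)$ on $M$ is a pair $(\alpha_1,\alpha_2)$ of $1$-forms such that $\alpha_1\wedge(d\alpha_1)^h\wedge\alpha_2\wedge(d\alpha_2)^k$ is a volume form, $(d\alpha_1)^{h+1}=0$ and $(d\alpha_2)^{k+1}=0$. Its Reeb vector fields $Z_1,Z_2$ are the two commuting vector fields uniquely determined by $\alpha_i(Z_j)=\delta_{ij}$ and $i_{Z_j}d\alpha_i=0$ for $i,j=1,2$. For $i=1,2$, the distribution $\ker\alpha_i\cap\ker d\alpha_i$ (where $\ker d\alpha_i=\{X : i_Xd\alpha_i=0\}$) is completely integrable and its foliation $\mathcal{F}_i$ is called the characteristic foliation of $\alpha_i$; $T\mathcal{F}_i$ denotes its tangent bundle. One has $TM=T\mathcal{F}_1\oplus T\mathcal{F}_2$. A contact pair structure on $M$ is a triple $(\alpha_1,\alpha_2,\phi)$ where $(\alpha_1,\alpha_2)$ is a contact pair and $\phi$ is a tensor field of type $(1,1)$ with $\phi^2=-Id+\alpha_1\otimes Z_1+\alpha_2\otimes Z_2$ and $\phi(Z_1)=\phi(Z_2)=0$. The endomorphism $\phi$ is decomposable if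 $\phi(T\mathcal{F}_i)\subset T\mathcal{F}_i$ for $i=1,2$. A Riemannian metric $g$ is associated with respect to $(\alpha_1,\alpha_2,\phi)$ if $g(X,\phi Y)=(d\alpha_1+d\alpha_2)(X,Y)$ and $g(X,Z_i)=\alpha_i(X)$ for $i=1,2$ and all $X,Y\in\Gamma(TM)$. A metric contact pair (MCP) is a $4$-tuple $(\alpha_1,\alpha_2,\phi,g)$ where $(\alpha_1,\alpha_2,\phi)$ is a contact pair structure and $g$ is an associated metric with respect to it. *)

(* Defs.v *)
From mathcomp Require Import all_boot all_order all_algebra all_fingroup.
From mathcomp Require Import all_classical all_reals all_analysis.

Set Implicit Arguments.
Unset Strict Implicit.
Unset Printing Implicit Defensive.

Import Order.TTheory GRing.Theory Num.Theory.
Import numFieldNormedType.Exports.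

Local Open Scope ring_scope.
Local Open Scope classical_set_scope.

(* C^oo on U (meant to be open): all iterated directional derivatives exist   *)
(* and are differentiable at every point of U.                                *)
Definition smooth_on (R : realType) (n : nat) (V : normedModType R)
    (U : set 'rV[R]_n) (f : 'rV[R]_n -> V) : Prop :=
  forall (s : seq 'rV[R]_n) (x : 'rV[R]_n), U x ->
    differentiable
      (foldr (fun v (g : 'rV[R]_n -> V) => fun y => 'D_v g y) f s) x.

(* chart_map and chart_inv are total functions, relevant only on chart_dom    *)
(* and on its image.                                                          *)
Record chart (R : realType) (n : nat) (M : topologicalType) := Chart {
  chart_dom : set M;
  chart_map : M -> 'rV[R]_n;
  chart_inv : 'rV[R]_n -> M;
  chart_dom_open : open chart_dom;
  chart_img_open : open (chart_map @` chart_dom);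
  chart_mapK : forall p, chart_dom p -> chart_inv (chart_map p) = p;
  chart_map_cont : forall p, chart_dom p -> {for p, continuous chart_map};
  chart_inv_cont : forall x, (chart_map @` chart_dom) x ->
    {for x, continuous chart_inv}
}.

Definition chart_img (R : realType) (n : nat) (M : topologicalType)
  (c : chart R n M) : set 'rV[R]_n := chart_map c @` chart_dom c.

(* A smooth n-manifold without boundary, presented by a (not necessarily      *)
(* maximal) C^oo atlas.  The datum chart_at selects, for each point, a chart  *)
(* of the atlas around it; it only serves to represent tangent spaces.        *)
Record manifold (R : realType) (n : nat) := Manifold {
  manifold_sort :> topologicalType;
  manifold_hausdorff : hausdorff_space manifold_sort;
  manifold_second_countable : @second_countable manifold_sort;
  atlas : set (chart R n manifold_sort);
  chart_at : manifold_sort -> chart R n manifold_sort;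
  chart_at_atlas : forall p, atlas (chart_at p);
  chart_at_dom : forall p, chart_dom (chart_at p) p;
  atlas_compat : forall c c', atlas c -> atlas c' ->
    smooth_on (chart_map c @` (chart_dom c `&` chart_dom c'))
      (chart_map c' \o chart_inv c)
}.

(* T_p M: a tangent vector at p is the row of its coordinates in the chart    *)
(* chart_at p.  Its coordinates in another chart are obtained by applying the *)
(* differential of the transition map: see tcoord and its inverse frame.      *)
Definition tangent (R : realType) (n : nat) (M : manifold R n) (p : M) :
  vectType R := 'rV[R]_n.

Section TensorFields.
Variables (R : realType) (n : nat) (M : manifold R n).

(* For x in the image of c: the tangent vector at the point chart_inv c x     *)
(* whose coordinates in the chart c are w.                                    *)
Definition frame (c : chart R n M) (x w : 'rV[R]_n) :
    tangent (chart_inv c x) :=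
  'd (chart_map (chart_at (chart_inv c x)) \o chart_inv c) x w.

(* The coordinates in the chart c of a tangent vector at p.                   *)
Definition tcoord (c : chart R n M) (p : M) (u : tangent p) : 'rV[R]_n :=
  'd (chart_map c \o chart_inv (chart_at p)) (chart_map (chart_at p) p) u.

Record vector_field := VectorField {
  vector_field_val :> forall p : M, tangent p;
  vector_field_smooth : forall c, atlas c ->
    smooth_on (chart_img c)
      (fun x => tcoord c (vector_field_val (chart_inv c x)))
}.

Record one_form := OneForm {
  one_form_val :> forall p : M, {scalar tangent p};
  one_form_smooth : forall c, atlas c -> forall w : 'rV[R]_n,
    smooth_on (chart_img c)
      (fun x => one_form_val (chart_inv c x) (frame c x w))
}.

(* Tensor fields of type (1,1), viewed as fields of endomorphisms.            *)
Record endo_field := EndoField {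
  endo_field_val :> forall p : M, {linear tangent p -> tangent p};
  endo_field_smooth : forall c, atlas c -> forall w : 'rV[R]_n,
    smooth_on (chart_img c)
      (fun x => tcoord c (endo_field_val (chart_inv c x) (frame c x w)))
}.

Record riemannian_metric := RiemannianMetric {
  metric_val :> forall p : M, {biscalar tangent p};
  metric_sym : forall p (u v : tangent p), metric_val p u v = metric_val p v u;
  metric_posdef : forall p (u : tangent p), u != 0 -> 0 < metric_val p u u;
  metric_smooth : forall c, atlas c -> forall w w' : 'rV[R]_n,
    smooth_on (chart_img c)
      (fun x => metric_val (chart_inv c x) (frame c x w) (frame c x w'))
}.

(* Exterior derivative of a 1-form, with the normalization                    *)
(*   (d alpha)(X, Y) = X (alpha Y) - Y (alpha X) - alpha [X, Y],              *)
(* evaluated at p on the coordinate fields of chart_at p that extend u and v  *)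
(* (these commute): sum_(i, j) (d_i alpha_j - d_j alpha_i) u_i v_j.           *)
Definition ext_d (alpha : one_form) (p : M) (u v : tangent p) : R :=
  let c := chart_at p in
  let x0 := chart_map c p in
  let comp (w : 'rV[R]_n) (x : 'rV[R]_n) : R :=
    alpha (chart_inv c x) (frame c x w) in
  'D_(u : 'rV[R]_n) (comp v) x0 - 'D_(v : 'rV[R]_n) (comp u) x0.

End TensorFields.

Section ExteriorAlgebra.
Variables (R : realType) (V : vectType R).

(* k-forms on V; all those used below are multilinear and alternating.        *)
Definition kform (k : nat) : Type := ('I_k -> V) -> R.

Definition form1 (a : V -> R) : kform 1 := fun v => a (v ord0).

Definition form2 (b : V -> V -> R) : kform 2 := fun v => b (v ord0) (v ord_max).

Definition wedge (k l : nat) (a : kform k) (b : kform l) : kform (k + l) :=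
  fun v => (k`! * l`!)%:R^-1 *
    \sum_(s : 'S_(k + l)) (-1) ^+ s *
      (a (fun i => v (s (lshift l i))) * b (fun j => v (s (rshift k j)))).

(* b ^ j for a 2-form b; b ^ 0 is the constant 0-form 1.                      *)
Fixpoint wedge_pow (b : kform 2) (j : nat) : kform (j * 2) :=
  match j with
  | 0 => fun _ => 1
  | i.+1 => wedge b (@wedge_pow b i)
  end.

End ExteriorAlgebra.

Arguments wedge_pow {R V} b j.

Section ContactPairs.
Variables (R : realType) (n : nat) (M : manifold R n).
Implicit Types (alpha : one_form M) (Z : vector_field M) (phi : endo_field M).

Definition is_volume_form (k : nat) (omega : forall p : M, kform (tangent p) k) :
    Prop :=
  k = n /\ forall p, exists v : 'I_k -> tangent p, omega p v != 0.

Definition d_pow alpha (j : nat) (p : M) : kform (tangent p) (j * 2) :=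
  wedge_pow (form2 (ext_d alpha (p := p))) j.

Arguments d_pow alpha j p : clear implicits.

Record is_contact_pair (h k : nat) alpha1 alpha2 : Prop := IsContactPair {
  contact_pair_volume : is_volume_form (fun p : M =>
    wedge (wedge (wedge (form1 (alpha1 p)) (d_pow alpha1 h p))
                 (form1 (alpha2 p)))
          (d_pow alpha2 k p));
  contact_pair_d1 : forall p v, d_pow alpha1 h.+1 p v = 0;
  contact_pair_d2 : forall p v, d_pow alpha2 k.+1 p v = 0
}.

Definition ker_d alpha (p : M) : set (tangent p) :=
  [set u | forall v, ext_d alpha u v = 0].

(* On a contact pair these equations have a unique solution, whose two fields *)
(* commute.                                                                   *)
Record are_reeb_fields alpha1 alpha2 Z1 Z2 : Prop := AreReebFields {
  reeb_11 : forall p, alpha1 p (Z1 p) = 1;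
  reeb_12 : forall p, alpha1 p (Z2 p) = 0;
  reeb_21 : forall p, alpha2 p (Z1 p) = 0;
  reeb_22 : forall p, alpha2 p (Z2 p) = 1;
  reeb_d11 : forall p, ker_d alpha1 (Z1 p);
  reeb_d12 : forall p, ker_d alpha1 (Z2 p);
  reeb_d21 : forall p, ker_d alpha2 (Z1 p);
  reeb_d22 : forall p, ker_d alpha2 (Z2 p)
}.

(* The characteristic foliation is given by its tangent bundle: this is the   *)
(* fibre at p of the integrable distribution (ker alpha) cap (ker d alpha).   *)
Definition char_foliation alpha (p : M) : set (tangent p) :=
  [set u | alpha p u = 0] `&` ker_d alpha (p := p).

Record is_contact_pair_structure (h k : nat) alpha1 alpha2 Z1 Z2 phi : Prop :=
    IsContactPairStructure {
  cps_contact_pair : is_contact_pair h k alpha1 alpha2;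
  cps_reeb : are_reeb_fields alpha1 alpha2 Z1 Z2;
  cps_sq : forall p (u : tangent p),
    phi p (phi p u) = - u + alpha1 p u *: Z1 p + alpha2 p u *: Z2 p;
  cps_Z1 : forall p, phi p (Z1 p) = 0;
  cps_Z2 : forall p, phi p (Z2 p) = 0
}.

Record is_associated_metric alpha1 alpha2 Z1 Z2 phi (g : riemannian_metric M) :
    Prop := IsAssociatedMetric {
  assoc_phi : forall p (u v : tangent p),
    g p u (phi p v) = ext_d alpha1 u v + ext_d alpha2 u v;
  assoc_Z1 : forall p (u : tangent p), g p u (Z1 p) = alpha1 p u;
  assoc_Z2 : forall p (u : tangent p), g p u (Z2 p) = alpha2 p u
}.

Record is_metric_contact_pair (h k : nat) alpha1 alpha2 Z1 Z2 phi
    (g : riemannian_metric M) : Prop := IsMetricContactPair {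
  mcp_structure : is_contact_pair_structure h k alpha1 alpha2 Z1 Z2 phi;
  mcp_metric : is_associated_metric alpha1 alpha2 Z1 Z2 phi g
}.

Definition preserves phi (F : forall p : M, set (tangent p)) : Prop :=
  forall p (u : tangent p), F p u -> F p (phi p u).

Definition decomposable alpha1 alpha2 phi : Prop :=
  preserves phi (char_foliation alpha1) /\
  preserves phi (char_foliation alpha2).

Definition orthogonal_foliations (g : riemannian_metric M)
    (F1 F2 : forall p : M, set (tangent p)) : Prop :=
  forall p (u v : tangent p), F1 p u -> F2 p v -> g p u v = 0.

End ContactPairs.

(* Main.v *)
(* For u in TF_1 and v in TF_2, i_u d(alpha_1) = i_v d(alpha_2) = 0 gives       *)
(* g(u, phi v) = g(v, phi u) = 0.  If phi preserves TF_2, replacing v by phi v  *)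
(* yields -g(u, v) = g(u, phi^2 v) = 0.  Conversely, if TF_1 and TF_2 are       *)
(* orthogonal, TM = TF_1 + TF_2 makes each the orthogonal of the other, and     *)
(* phi(TF_1) is orthogonal to TF_2.                                             *)
(* For the splitting, d(alpha)^j(v_1, .., v_2j) <> 0 and d(alpha)^(j+1) = 0     *)
(* force every u with d(alpha)(u, v_i) = 0 for all i into ker d(alpha), since   *)
(* d(alpha)^(j+1)(u, w, v_1, .., v_2j) is then a nonzero multiple of            *)
(* d(alpha)(u, w) d(alpha)^j(v_1, .., v_2j).  So TF_1 and TF_2 have codimension *)
(* at most 2h + 1 and 2k + 1, where dim M = 2h + 2k + 2, and they meet          *)
(* trivially because g is definite.                                             *)

Require Import Defs.
From HB Require Import structures.
From mathcomp Require Import all_boot all_order all_algebra all_fingroup.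
From mathcomp Require Import all_classical all_reals all_analysis.
From mathcomp Require Import zify.

Set Implicit Arguments.
Unset Strict Implicit.
Unset Printing Implicit Defensive.

Import Order.TTheory GRing.Theory Num.Theory.
Import numFieldNormedType.Exports.

Local Open Scope ring_scope.

(** The nonzero multiple behind the kernel argument is found on a sum over permutations:
    [wedge_powE] identifies b^j with 2^-j times [pfsum], and [pfsum_rec] expands [pfsum] when the
    first argument pairs to zero with itself and with all others but the second. This gives
    [wedge_pow_ker], hence the codimension bound [char_foliation_dim] and the splitting
    [char_foliations_span]. *)

(** * Permutations fixing the first two indices *)

Lemma lift0_perm_surj (m : nat) (s : 'S_m.+1) :
  s ord0 = ord0 -> exists t : 'S_m, s = lift_perm ord0 ord0 t.
Proof.
move=> s0.
have s_lift k : exists i, s (lift ord0 k) = lift ord0 i.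
  case: (unliftP ord0 (s (lift ord0 k))) => [i ->|]; first by exists i.
  by rewrite -{2}s0 => /perm_inj/eqP; rewrite eq_sym (negPf (neq_lift _ _)).
have [f fE] := boolp.choice s_lift.
have f_inj : injective f.
  by move=> i j fij; apply/(@lift_inj _ ord0)/(@perm_inj _ s); rewrite !fE fij.
exists (perm f_inj); apply/permP=> k.
by case: (unliftP ord0 k) => [i|] ->; rewrite ?lift_perm_id // lift_perm_lift permE.
Qed.

Definition lift2_perm (m : nat) (t : 'S_m) : 'S_m.+2 :=
  lift_perm ord0 ord0 (lift_perm ord0 ord0 t).

Lemma lift2_permE (m : nat) (t : 'S_m) (k : 'I_m) :
  lift2_perm t (rshift 2 k) = rshift 2 (t k).
Proof.
have -> j : rshift 2 j = lift ord0 (lift ord0 j) :> 'I_m.+2 by apply: val_inj.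
by rewrite !lift_perm_lift; apply: val_inj.
Qed.

Lemma lift2_perm0 (m : nat) (t : 'S_m) : lift2_perm t ord0 = ord0.
Proof. exact: lift_perm_id. Qed.

Lemma lift2_perm1 (m : nat) (t : 'S_m) :
  lift2_perm t (lift ord0 ord0) = lift ord0 ord0.
Proof. by rewrite lift_perm_lift lift_perm_id. Qed.

Lemma odd_lift2_perm (m : nat) (t : 'S_m) : lift2_perm t = t :> bool.
Proof. by rewrite !odd_lift_perm. Qed.

Lemma lift2_perm_inj (m : nat) : injective (@lift2_perm m).
Proof.
move=> s t st; apply/permP => k; apply: (@rshift_inj 2).
by rewrite -!lift2_permE st.
Qed.

Lemma lift2_perm_surj (m : nat) (s : 'S_m.+2) :
  s ord0 = ord0 -> s (lift ord0 ord0) = lift ord0 ord0 ->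
  exists t : 'S_m, s = lift2_perm t.
Proof.
move=> /lift0_perm_surj[t ->]; rewrite lift_perm_lift.
by move=> /lift_inj/lift0_perm_surj[u ->]; exists u.
Qed.

Lemma big_lift2_perm (R : nmodType) (m : nat) (F : 'S_m.+2 -> R) :
  \sum_(s : 'S_m.+2 | (s ord0 == ord0) && (s (lift ord0 ord0) == lift ord0 ord0)) F s =
  \sum_(t : 'S_m) F (lift2_perm t).
Proof.
rewrite (reindex (@lift2_perm m)).
  by apply: eq_bigl => t; rewrite lift2_perm0 lift2_perm1 !eqxx.
(* The default 1 is reached only off the stabilizer of 0 and 1, outside the range of summation. *)
exists (fun s => odflt 1%g [pick t | s == lift2_perm t]) => s.
  by case: pickP => [t /eqP/lift2_perm_inj-> //|/(_ s)]; rewrite eqxx.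
move=> /andP[/eqP s0 /eqP s1]; case: pickP => [t /eqP //|].
by have [t ->] := lift2_perm_surj s0 s1 => /(_ t); rewrite eqxx.
Qed.

(** * Positions grouped in consecutive pairs *)

Lemma even_ord_subproof (j : nat) (i : 'I_j) : (i * 2 < j * 2)%N.
Proof. by rewrite ltn_pmul2r. Qed.

Lemma odd_ord_subproof (j : nat) (i : 'I_j) : ((i * 2).+1 < j * 2)%N.
Proof. by rewrite !muln2 ltn_Sdouble. Qed.

Definition even_ord (j : nat) (i : 'I_j) : 'I_(j * 2) :=
  Ordinal (even_ord_subproof i).

Definition odd_ord (j : nat) (i : 'I_j) : 'I_(j * 2) :=
  Ordinal (odd_ord_subproof i).

Lemma even_ord_inj j : injective (@even_ord j).
Proof. by move=> i k [] /eqP; rewrite eqn_pmul2r // => /eqP/val_inj. Qed.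

Lemma odd_ord_inj j : injective (@odd_ord j).
Proof. by move=> i k [] /eqP; rewrite eqn_pmul2r // => /eqP/val_inj. Qed.

Lemma even_ord_neq_odd j (i k : 'I_j) : (even_ord i == odd_ord k) = false.
Proof.
apply/negP => /eqP[] /(congr1 odd) /=.
by rewrite !muln2 !odd_double.
Qed.

Lemma even_ord0 j : even_ord (@ord0 j) = ord0.
Proof. exact: val_inj. Qed.

Lemma odd_ord0 j : odd_ord (@ord0 j) = lift ord0 ord0.
Proof. exact: val_inj. Qed.

Lemma even_ord_lift j (i : 'I_j) : even_ord (lift ord0 i) = rshift 2 (even_ord i).
Proof. exact: val_inj. Qed.

Lemma odd_ord_lift j (i : 'I_j) : odd_ord (lift ord0 i) = rshift 2 (odd_ord i).
Proof. exact: val_inj. Qed.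

Lemma even_or_odd_ord j (p : 'I_(j * 2)) :
  (exists i, p = even_ord i) \/ (exists i, p = odd_ord i).
Proof.
have lt : (p./2 < j)%N by rewrite ltn_half_double -muln2.
have := odd_double_half p; case: odd => /= pE; [right|left]; exists (Ordinal lt);
  by apply: val_inj; rewrite /= (muln2 p./2); exact/esym.
Qed.

(** * Pfaffian sums *)

Section Pfaffian.
Variables (R : comNzRingType) (V : Type) (b : V -> V -> R).

Definition pfterm j (x : 'I_(j * 2) -> V) (s : 'S_(j * 2)) : R :=
  (-1) ^+ s * \prod_(i < j) b (x (s (even_ord i))) (x (s (odd_ord i))).

(* 2 ^ j * j! times the Pfaffian of the matrix b (x k) (x l).                   *)
Definition pfsum j (x : 'I_(j * 2) -> V) : R := \sum_s pfterm x s.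

(** The product applies [lift2_perm t] first, so the first pair sees only s, and t shuffles the
    other positions before s acts. This matches the recursion of [wedge_pow]. *)
Lemma pfterm_lift2 j (x : 'I_(j.+1 * 2) -> V) (t : 'S_(j * 2)) (s : 'S_(j.+1 * 2)) :
  pfterm x ((lift2_perm t : 'S_(j.+1 * 2)) * s)%g =
  (-1) ^+ s * (b (x (s ord0)) (x (s (lift ord0 ord0)))
   * pfterm (fun k => x (s (rshift 2 k))) t).
Proof.
rewrite /pfterm odd_permM odd_lift2_perm signr_addb big_ord_recl.
rewrite even_ord0 odd_ord0 !permM.
rewrite lift2_perm0 lift2_perm1 [_ * (-1) ^+ s]mulrC -mulrA; congr (_ * _).
rewrite mulrCA; congr (_ * (_ * _)).
by apply: eq_bigr => i _; rewrite even_ord_lift odd_ord_lift !permM !lift2_permE.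
Qed.

Hypothesis bN : forall u v, b u v = - b v u.

(** Exchanging pair i with pair 0 is an even permutation that only reorders the factors. *)
Lemma pfsum_even_ord j (x : 'I_(j.+1 * 2) -> V) (i : 'I_j.+1) :
  \sum_(s : 'S_(j.+1 * 2) | s (even_ord i) == ord0) pfterm x s =
  \sum_(s : 'S_(j.+1 * 2) | s ord0 == ord0) pfterm x s.
Proof.
pose t := (tperm (even_ord i) (even_ord ord0) * tperm (odd_ord i) (odd_ord ord0))%g.
have tev k : t (even_ord k) = even_ord (tperm i ord0 k).
  rewrite permM -(inj_tperm _ _ _ (@even_ord_inj j.+1)).
  by rewrite tpermD // eq_sym even_ord_neq_odd.
have tod k : t (odd_ord k) = odd_ord (tperm i ord0 k).
  rewrite permM (@tpermD _ (even_ord i)) ?even_ord_neq_odd //.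
  by rewrite -(inj_tperm _ _ _ (@odd_ord_inj j.+1)).
(* The two transpositions have equal parity, also when i = 0 and both are trivial. *)
have todd : t = false :> bool.
  rewrite odd_permM !odd_tperm (inj_eq (@even_ord_inj j.+1)).
  rewrite (inj_eq (@odd_ord_inj j.+1)).
  exact: addbb.
rewrite (reindex_inj (mulgI t)); apply: eq_big => [s|s _].
  by rewrite permM tev tpermL even_ord0.
rewrite /pfterm odd_permM todd; congr (_ * _).
rewrite [RHS](reindex_inj (@perm_inj _ (tperm i ord0))).
by apply: eq_bigr => k _; rewrite !(permM t s) tev tod.
Qed.

(** Swapping inside pair i changes the sign of the permutation and, by antisymmetry, that of factor
    i. *)
Lemma pfsum_odd_ord j (x : 'I_(j.+1 * 2) -> V) (i : 'I_j.+1) :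
  \sum_(s : 'S_(j.+1 * 2) | s (odd_ord i) == ord0) pfterm x s =
  \sum_(s : 'S_(j.+1 * 2) | s (even_ord i) == ord0) pfterm x s.
Proof.
pose t := tperm (even_ord i) (odd_ord i).
rewrite (reindex_inj (mulgI t)); apply: eq_big => [s|s _].
  by rewrite permM tpermR.
rewrite /pfterm odd_permM odd_tperm even_ord_neq_odd signr_addb mulN1r mulNr -mulrN.
congr (_ * _).
rewrite (bigD1 i) //= [in RHS](bigD1 i) //= !permM tpermL tpermR bN mulNr opprK.
congr (_ * _); apply: eq_bigr => k ki.
rewrite !permM !tpermD ?(inj_eq (@even_ord_inj j.+1))
  ?(inj_eq (@odd_ord_inj j.+1)) //;
  by rewrite 1?[odd_ord _ == _]eq_sym ?even_ord_neq_odd // eq_sym.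
Qed.

(* The sum is split along the position s^-1 0 of the argument x 0; permuting    *)
(* the pairs, or swapping inside one, brings that position to 0 without         *)
(* changing the partial sum.                                                    *)
Lemma pfsum_rec j (x : 'I_(j.+1 * 2) -> V) :
  (forall k : 'I_(j * 2), b (x ord0) (x (rshift 2 k)) = 0) ->
  b (x ord0) (x ord0) = 0 ->
  pfsum x = (j.+1 * 2)%:R * (b (x ord0) (x (lift ord0 ord0))
            * pfsum (fun k => x (rshift 2 k))).
Proof.
move=> x0 x00; rewrite /pfsum.
rewrite (partition_big (fun s : 'S_(j.+1 * 2) => s^-1%g ord0) predT) //=.
rewrite (eq_bigr (fun=> \sum_(s : 'S_(j.+1 * 2) | s ord0 == ord0) pfterm x s)).
  rewrite sumr_const card_ord mulr_natl; congr (_ *+ _).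
  (* When s fixes 0, its first factor pairs x 0 with x (s 1), hence vanishes unless s fixes 1. *)
  rewrite (bigID (fun s : 'S_(j.+1 * 2) => s (lift ord0 ord0) == lift ord0 ord0)) /=.
  rewrite [X in _ + X]big1 ?addr0 => [|s /andP[/eqP s0 s1]].
    rewrite big_lift2_perm mulr_sumr; apply: eq_bigr => t _.
    have := pfterm_lift2 x t 1%g.
    rewrite mulg1 => ->; rewrite odd_perm1 mul1r !perm1; congr (_ * (_ * _)).
    by apply: eq_bigr => k _; rewrite !perm1.
  rewrite /pfterm big_ord_recl even_ord0 odd_ord0 s0.
  suff -> : b (x ord0) (x (s (lift ord0 ord0))) = 0 by rewrite mul0r mulr0.
  case: (unliftP ord0 (s (lift ord0 ord0))) s1 => [k ->|-> //].
  case: (unliftP ord0 k) => [l ->|->]; last by rewrite eqxx.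
  move=> _; have -> : lift ord0 (lift ord0 l) = rshift 2 l :> 'I_(j.+1 * 2).
    exact: val_inj.
  exact: x0.
move=> p _.
rewrite (eq_bigl (fun s : 'S_(j.+1 * 2) => s p == ord0)); last first.
  by move=> s; rewrite -(inj_eq (@perm_inj _ s)) permKV eq_sym.
by have [[i ->]|[i ->]] := even_or_odd_ord p; rewrite ?pfsum_odd_ord pfsum_even_ord.
Qed.

End Pfaffian.

(** * Powers of a 2-form and their kernels *)

(** For each inner permutation t, translation by [lift2_perm t] is a bijection, so the double sum is
    (2j)! times one [pfsum]. This cancels the (2j)! of [wedge], and its 2! adds one factor 1/2. *)
Lemma wedge_powE (R : realType) (V : vectType R) (b : V -> V -> R) j
    (x : 'I_(j * 2) -> V) :
  wedge_pow (form2 b) j x = (2 ^ j)%:R^-1 * pfsum b x.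
Proof.
elim: j x => [|j IH] x.
  rewrite /= expn0 invr1 mul1r /pfsum (big_pred1 1%g) /=; last first.
    by move=> s; apply/esym/eqP/permP => -[].
  by rewrite /pfterm odd_perm1 big_ord0 mulr1.
rewrite /= /wedge (eq_bigr (fun s => (2 ^ j)%:R^-1 *
    \sum_t pfterm b x ((lift2_perm t : 'S_(j.+1 * 2)) * s)%g)); last first.
  move=> s _; under [in RHS]eq_bigr do rewrite pfterm_lift2.
  rewrite -!mulr_sumr IH [X in _ * X = _]mulrCA [RHS]mulrCA /form2.
  by congr (_ * (_ * (b (x (s _)) (x (s _)) * _))); apply: val_inj.
rewrite -mulr_sumr exchange_big /=.
rewrite (eq_bigr (fun=> pfsum b x)) => [|t _]; last first.
  by rewrite [RHS](reindex_inj (mulgI (lift2_perm t : 'S_(j.+1 * 2)))).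
rewrite sumr_const card_Sn -[pfsum _ _ *+ _]mulr_natl !mulrA; congr (_ * _).
have fact_neq0 : ((j * 2)`!)%:R != 0 :> R by rewrite pnatr_eq0 -lt0n fact_gt0.
by rewrite expnS !(natrM _ 2) !invfM [_ / (2 ^ j)%:R]mulrAC divfK.
Qed.

Lemma wedge_neq0 (R : realType) (V : vectType R) k l (a : kform V k)
    (b : kform V l) v :
  wedge a b v != 0 -> (exists x, a x != 0) /\ (exists y, b y != 0).
Proof.
move=> ab; split; apply: contrapT => no; case/eqP: ab; rewrite /wedge big1 ?mulr0 //.
  move=> s _; set x := (X in a X).
  have -> : a x = 0 by apply: contrapT => /eqP ax; apply: no; exists x.
  by rewrite mul0r mulr0.
move=> s _; set y := (X in b X).
have -> : b y = 0 by apply: contrapT => /eqP bx; apply: no; exists y.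
by rewrite !mulr0.
Qed.

Lemma wedge_pow_ker (R : realType) (V : vectType R) (b : V -> V -> R) j
    (v : 'I_(j * 2) -> V) :
  (forall x y, b x y = - b y x) ->
  wedge_pow (form2 b) j v != 0 -> (forall x, wedge_pow (form2 b) j.+1 x = 0) ->
  forall u, (forall i, b u (v i) = 0) -> forall w, b u w = 0.
Proof.
move=> bN bv bS u uv w.
have buu : b u u = 0.
  by apply/eqP; rewrite -[_ == 0](mulrn_eq0 _ 2) mulr2n {1}bN addNr.
(* The argument list u, w, v_1, .., v_2j. *)
pose x (k : 'I_(j.+1 * 2)) := match fintype.split (k : 'I_(2 + j * 2)) with
  | inl i => if i == ord0 then u else w
  | inr i => v i
  end.
have xl (i : 'I_2) : x (lshift (j * 2) i) = if i == ord0 then u else w.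
  by rewrite /x (unsplitK (inl _)).
have x0 : x ord0 = u.
  by rewrite -[RHS](xl ord0); congr x; apply: val_inj.
have x1 : x (lift ord0 ord0) = w.
  by rewrite -[RHS](xl (lift ord0 ord0)); congr x; apply: val_inj.
have x2 k : x (rshift 2 k) = v k by rewrite /x (unsplitK (inr _)).
have := bS x; rewrite wedge_powE pfsum_rec ?x0 // => [|k]; last by rewrite x2.
rewrite x1 (_ : (fun k => x (rshift 2 k)) = v); last exact/funext.
move: bv; rewrite wedge_powE mulf_eq0 negb_or => /andP[_ v0].
move/eqP; rewrite !mulf_eq0 invr_eq0 !pnatr_eq0 (negPf v0) orbF expn_eq0 /=.
by move/eqP.
Qed.

(** * Codimension of a characteristic foliation *)

Lemma common_kernel (F : fieldType) (n m : nat) (f : 'I_m -> 'rV[F]_n -> F) :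
  (forall i, scalar (f i)) ->
  exists K : 'M[F]_n, (n <= \rank K + m)%N /\
    forall u : 'rV_n, (u <= K)%MS -> forall i, f i u = 0.
Proof.
move=> f_lin; pose A := \matrix_(i, j) f j (delta_mx 0 i) : 'M[F]_(n, m).
exists (kermx A); split.
  by rewrite mxrank_ker addnC -leq_subLR leq_sub2l ?rank_leq_col.
move=> u /sub_kermxP/rowP uA i; have := uA i; rewrite !mxE => <-.
pose fL := GRing.isLinear.Build _ _ _ _ (f i) (f_lin i).
pose g : {scalar 'rV[F]_n} := HB.pack (f i) fL.
rewrite -[f i]/(g : _ -> _) {1}[u]row_sum_delta linear_sum.
by apply: eq_bigr => k _; rewrite linearZ mxE.
Qed.

Section ExtD.
Variables (R : realType) (n : nat) (M : manifold R n) (alpha : one_form M) (p : M).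
Implicit Types u v w : tangent p.

Lemma ext_dN u v : ext_d alpha u v = - ext_d alpha v u.
Proof. by rewrite /ext_d opprB. Qed.

(** Here u is both a direction of differentiation and the vector extended by [frame];
    differentiability of the components of [alpha] gives linearity in both roles. *)
Lemma ext_d_scalar v : scalar (fun u => ext_d alpha u v).
Proof.
move=> a u w.
set c := chart_at p; set x0 := chart_map c p.
pose comp w x : R := alpha (chart_inv c x) (frame c x w).
have ext_dE u' w' : ext_d alpha u' w' = 'D_u' (comp w') x0 - 'D_w' (comp u') x0.
  by [].
have dcomp w' : differentiable (comp w') x0.
  (* The empty list of directions yields differentiability of the component itself. *)
  have /(_ [::] x0) := one_form_smooth alpha (chart_at_atlas p) w'.
  by apply; exists p => //; apply: chart_at_dom.
have compP : comp (a *: u + w) = a \*: comp u + comp w.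
  by apply/funext => x; rewrite [LHS]/comp /frame !linearP.
have der w' v' : derivable (comp w') x0 v' by apply: diff_derivable.
rewrite !ext_dE compP deriveD ?deriveZ //; last exact: derivableZ.
rewrite !deriveE // linearP /= opprD addrACA; congr (_ + _).
exact/esym/mulrBr.
Qed.

End ExtD.

Lemma char_foliation_dim (R : realType) (n : nat) (M : manifold R n) (j : nat)
    (alpha : one_form M) (p : M) x :
  wedge_pow (form2 (@ext_d _ _ _ alpha p)) j x != 0 ->
  (forall y, wedge_pow (form2 (@ext_d _ _ _ alpha p)) j.+1 y = 0) ->
  exists K : 'M[R]_n, (n <= \rank K + (j * 2).+1)%N /\
    forall u : 'rV[R]_n, (u <= K)%MS -> char_foliation alpha (u : tangent p).
Proof.
move=> x0 top0.
pose f (i : 'I_(j * 2).+1) (u : 'rV[R]_n) : R :=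
  if unlift ord0 i is Some l then ext_d alpha (u : tangent p) (x l)
  else alpha p u.
have [i|K [rK Kf]] := @common_kernel R n _ f.
  rewrite /f; case: unlift => [l|]; first exact: ext_d_scalar.
  exact: linearP.
exists K; split => // u /Kf fu; split.
  by have := fu ord0; rewrite /f unlift_none.
apply: (wedge_pow_ker _ x0 top0) => [*|i]; first exact: ext_dN.
by have := fu (lift ord0 i); rewrite /f liftK.
Qed.

(** * Splitting and orthogonality for a metric contact pair *)

Section MetricContactPair.
Variables (R : realType) (n : nat) (M : manifold R n) (h k : nat).
Variables (alpha1 alpha2 : one_form M) (Z1 Z2 : vector_field M).
Variables (phi : endo_field M) (g : riemannian_metric M).
Hypothesis hmcp : is_metric_contact_pair h k alpha1 alpha2 Z1 Z2 phi g.

Lemma char_foliation_phi (p : M) (u v : tangent p) :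
  char_foliation alpha1 u -> char_foliation alpha2 v ->
  g p u (phi p v) = 0 /\ g p v (phi p u) = 0.
Proof.
move=> [_ u1] [_ v2]; rewrite !(assoc_phi (mcp_metric hmcp)).
rewrite [ext_d alpha1 v u]ext_dN [ext_d alpha2 u v]ext_dN.
by rewrite [ext_d alpha1 u v]u1 [ext_d alpha2 v u]v2 oppr0 addr0.
Qed.

Lemma metric_phi_sq (p : M) (u v : tangent p) :
  g p u (phi p (phi p v)) =
  - g p u v + alpha1 p v * alpha1 p u + alpha2 p v * alpha2 p u.
Proof.
rewrite (cps_sq (mcp_structure hmcp)) !linearD linearN !linearZ /=.
by rewrite (assoc_Z1 (mcp_metric hmcp)) (assoc_Z2 (mcp_metric hmcp)).
Qed.

Lemma metric_eq0 (p : M) (u : tangent p) : g p u u = 0 -> u = 0.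
Proof.
move=> guu; apply/eqP; apply: contraT => /(metric_posdef g).
by rewrite guu ltxx.
Qed.

(** Such a u is in both kernels, so g(u, phi^2 u) = 0; as both forms vanish on u, this is also -g(u,
    u). *)
Lemma char_foliations_disjoint (p : M) (u : tangent p) :
  char_foliation alpha1 u -> char_foliation alpha2 u -> u = 0.
Proof.
move=> [u1 du1] [u2 du2]; apply: metric_eq0.
have := metric_phi_sq u u; rewrite (assoc_phi (mcp_metric hmcp)).
rewrite [ext_d alpha1 _ _]du1 [ext_d alpha2 _ _]du2 u1 u2 !mul0r !addr0.
by move/esym/eqP; rewrite oppr_eq0 => /eqP.
Qed.

Lemma d_pow_neq0 (p : M) :
  (exists x, wedge_pow (form2 (@ext_d _ _ _ alpha1 p)) h x != 0) /\
  (exists x, wedge_pow (form2 (@ext_d _ _ _ alpha2 p)) k x != 0).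
Proof.
have [_ /(_ p)[v]] := contact_pair_volume (cps_contact_pair (mcp_structure hmcp)).
move=> /wedge_neq0[[x] /wedge_neq0[[y] /wedge_neq0[_ ?] _] ?]; split => //.
Qed.

Lemma char_foliations_span (p : M) (w : tangent p) :
  exists u v : tangent p,
    [/\ char_foliation alpha1 u, char_foliation alpha2 v & w = u + v].
Proof.
have cp := cps_contact_pair (mcp_structure hmcp).
have [[x x0] [y y0]] := d_pow_neq0 p.
have [K1 [rK1 K1P]] := char_foliation_dim x0 (contact_pair_d1 cp (p := p)).
have [K2 [rK2 K2P]] := char_foliation_dim y0 (contact_pair_d2 cp (p := p)).
have [dim_n _] := contact_pair_volume cp.
have K12 : (K1 :&: K2)%MS = 0.
  apply/eqP/rowV0P => u; rewrite sub_capmx => /andP[/K1P u1 /K2P u2].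
  exact: (char_foliations_disjoint u1 u2).
have full : row_full (K1 + K2)%MS.
  (* The ranks add up to at least 2n - (2h + 1) - (2k + 1) = n. *)
  rewrite -col_leq_rank mxrank_disjoint_sum //.
  move: rK1 rK2 dim_n; clear; lia.
have /sub_addsmxP[[a b] /= wE] := submx_full (w : 'rV[R]_n) full.
by exists (a *m K1), (b *m K2); split => //; [apply: K1P|apply: K2P]; apply: submxMl.
Qed.

(** The TF_2 component of w is orthogonal to w and to the TF_1 component, hence to itself. *)
Lemma orthogonal_char_foliation2 (p : M) (w : tangent p) :
  orthogonal_foliations g (char_foliation alpha1) (char_foliation alpha2) ->
  (forall v, char_foliation alpha2 v -> g p v w = 0) -> char_foliation alpha1 w.
Proof.
move=> F12 w2; have [u [v [Fu Fv wE]]] := char_foliations_span w.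
have := w2 v Fv; rewrite wE linearD /= Defs.metric_sym (F12 p u v Fu Fv) add0r.
by move=> /metric_eq0 ->; rewrite addr0.
Qed.

Lemma orthogonal_char_foliation1 (p : M) (w : tangent p) :
  orthogonal_foliations g (char_foliation alpha1) (char_foliation alpha2) ->
  (forall u, char_foliation alpha1 u -> g p u w = 0) -> char_foliation alpha2 w.
Proof.
move=> F12 w1; have [u [v [Fu Fv wE]]] := char_foliations_span w.
have := w1 u Fu; rewrite wE linearD /= (F12 p u v Fu Fv) addr0.
by move=> /metric_eq0 ->; rewrite add0r.
Qed.

End MetricContactPair.

Theorem theorem18 (R : realType) (n : nat) (M : manifold R n) (h k : nat)
    (alpha1 alpha2 : one_form M) (Z1 Z2 : vector_field M)
    (phi : endo_field M) (g : riemannian_metric M)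
    (hmcp : is_metric_contact_pair h k alpha1 alpha2 Z1 Z2 phi g) :
  decomposable alpha1 alpha2 phi <->
  orthogonal_foliations g (char_foliation alpha1) (char_foliation alpha2).
Proof.
split=> [[_ phi2] p u v Fu Fv | F12].
  have [+ _] := char_foliation_phi hmcp Fu (phi2 p v Fv).
  rewrite (metric_phi_sq hmcp).
  have [u1 _] := Fu; have [v2 _] := Fv; rewrite u1 v2 mulr0 mul0r !addr0.
  by move/eqP; rewrite oppr_eq0 => /eqP.
split=> p u Fu.
  apply: (orthogonal_char_foliation2 hmcp F12) => v Fv.
  by have [] := char_foliation_phi hmcp Fu Fv.
apply: (orthogonal_char_foliation1 hmcp F12) => v Fv.
by have [] := char_foliation_phi hmcp Fv Fu.
Qed.
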